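(* Let $X$ be a real Banach space and let $Y$ be a finite dimensional subspace of $X$ such that the (quotient) norm of $X/Y$ is weakly average non rough. Then the norm of $X$ is weakly average non rough.
   Context: All Banach spaces are real. $B_{Z}$ denotes the closed unit ball of $Z$. For a Banach space $Z$ and $\varepsilon>0$, the norm of $Z$ is weakly $\varepsilon$-average rough if every nonempty relatively $w^*$-open subset of $B_{Z^*}$ has diameter $\geq\varepsilon$. The norm of $Z$ is weakly average non rough if it is not weakly $\varepsilon$-average rough for any $\varepsilon>0$. *)

(* Defs.v *)
From HB Require Import structures.
From mathcomp Require Import all_boot all_order all_algebra.
From mathcomp Require Import generic_quotient ring_quotient.
From mathcomp Require Import all_classical all_reals all_analysis.

Set Implicit Arguments.
Unset Strict Implicit.
Unset Printing Implicit Defensive.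

Import Order.TTheory GRing.Theory Num.Theory.
Import numFieldNormedType.Exports.

Local Open Scope classical_set_scope.
Local Open Scope ring_scope.

Section closed_unit_ball.
Context {R : realType}.

Definition unit_ball (Z : normedModType R) : set Z := [set x | `|x| <= 1].
Arguments unit_ball Z : clear implicits.

Lemma unit_ball0 (Z : normedModType R) : unit_ball Z 0.
Proof. by rewrite /unit_ball/= normr0. Qed.

End closed_unit_ball.
Arguments unit_ball {R} Z.

Section dual_space.
Context {R : realType} (Z : normedModType R).

Definition dual_pred : {pred Z -> R^o} :=
  mem [set f : Z -> R^o | linear f /\ continuous f].

Lemma dual_pred_submod_closed : submod_closed dual_pred.
Proof.
split=> [|a f g /[!inE] -[lf cf] [lg cg]].
  rewrite inE; split=> [b x y|]; last exact: cst_continuous.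
  by rewrite /= addr0 -[RHS]/(b * 0) mulr0.
split=> [b x y|x].
  rewrite -[LHS]/(a *: f (b *: x + y) + g (b *: x + y)) lf lg.
  rewrite -[in RHS]/(b *: (a *: f x + g x) + (a *: f y + g y)).
  by rewrite !scalerDr !scalerA (mulrC a) addrACA.
by apply: (@cvgD _ R^o); [apply: (@cvgZr _ R^o); exact: cf|exact: cg].
Qed.

HB.instance Definition _ :=
  GRing.isSubmodClosed.Build R (Z -> R^o) dual_pred dual_pred_submod_closed.

Record dual_space := Dual {
  dual_fun :> Z -> R^o ;
  dual_funP : dual_fun \in dual_pred
}.

HB.instance Definition _ := [isSub for dual_fun].
HB.instance Definition _ := [Choice of dual_space by <:].
HB.instance Definition _ := [SubChoice_isSubLmodule of dual_space by <:].

Lemma dual_linear (f : dual_space) : linear f.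
Proof. by have := dual_funP f; rewrite inE => -[]. Qed.

Lemma dual_continuous (f : dual_space) : continuous f.
Proof. by have := dual_funP f; rewrite inE => -[]. Qed.

HB.instance Definition _ (f : dual_space) :=
  GRing.isLinear.Build R Z R^o *:%R (dual_fun f) (dual_linear f).

Lemma dual_funD (f g : dual_space) x : (f + g) x = f x + g x.
Proof. by []. Qed.

Lemma dual_funN (f : dual_space) x : (- f) x = - f x.
Proof. by []. Qed.

Lemma dual_funZ (a : R) (f : dual_space) x : (a *: f) x = a * f x.
Proof. by []. Qed.

Definition dual_norm (f : dual_space) : R :=
  sup [set `|f x| | x in unit_ball Z].

Lemma dual_has_sup (f : dual_space) :
  has_sup [set `|f x| | x in unit_ball Z].
Proof.
split; first by exists `|f 0|; exists 0 => //; exact: unit_ball0.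
have /linear_boundedP : bounded_near f (nbhs (0 : Z)).
  by apply: continuous_linear_bounded; exact: dual_continuous.
move=> /pinfty_ex_gt0 [M M0 fM]; exists M => _ [x x1 <-].
by rewrite (le_trans (fM x))// ler_piMr// ltW.
Qed.

Lemma dual_norm_ub (f : dual_space) x : unit_ball Z x -> `|f x| <= dual_norm f.
Proof.
by move=> x1; apply: ub_le_sup; [exact: (dual_has_sup f).2|exists x].
Qed.

Lemma dual_norm_le (f : dual_space) r :
  (forall x, unit_ball Z x -> `|f x| <= r) -> dual_norm f <= r.
Proof.
move=> fr; apply: ge_sup; first exact: (dual_has_sup f).1.
by move=> _ [x x1 <-]; exact: fr.
Qed.

Lemma dual_norm_ge0 (f : dual_space) : 0 <= dual_norm f.
Proof. exact: le_trans (dual_norm_ub f (unit_ball0 Z)). Qed.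

Lemma dual_normD f g : dual_norm (f + g) <= dual_norm f + dual_norm g.
Proof.
apply: dual_norm_le => x x1; rewrite dual_funD (le_trans (ler_normD _ _))//.
by rewrite lerD// dual_norm_ub.
Qed.

Lemma dual_normZ (a : R) f : dual_norm (a *: f) = `|a| * dual_norm f.
Proof.
have le_normZ b g : dual_norm (b *: g) <= `|b| * dual_norm g.
  apply: dual_norm_le => x x1.
  by rewrite dual_funZ normrM ler_wpM2l// dual_norm_ub.
apply/eqP; rewrite eq_le le_normZ /=.
have [->|a0] := eqVneq a 0; first by rewrite normr0 mul0r dual_norm_ge0.
rewrite -ler_pdivlMl ?normr_gt0// -normfV.
by rewrite (le_trans _ (le_normZ _ _))// scalerA mulVf// scale1r.
Qed.

Lemma dual_norm0_eq0 f : dual_norm f = 0 -> f = 0.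
Proof.
move=> f0; apply/val_inj/funext => x /=.
have [->|x0] := eqVneq x 0; first exact: linear0.
have /(dual_norm_ub f) : unit_ball Z (`|x|^-1 *: x).
  by rewrite /unit_ball/= normfZV.
rewrite f0 normr_le0 linearZ/= scaler_eq0 invr_eq0 normr_eq0 (negbTE x0)/=.
by move/eqP.
Qed.

HB.instance Definition _ := Lmodule_isNormed.Build R dual_space
  dual_normD dual_normZ dual_norm0_eq0.

Lemma dual_normE (f : dual_space) :
  `|f| = sup [set `|f x| | x in unit_ball Z].
Proof. by []. Qed.

Definition dual_eval : dual_space -> {ptws Z -> R^o} := dual_fun.

(* [dual_space] itself carries the topology of the dual norm. *)
Definition weak_star : Type := initial_topology dual_eval.
HB.instance Definition _ := Topological.on weak_star.

Definition weak_star_open (W : set dual_space) : Prop :=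
  open (W : set weak_star).

Lemma weak_star_openE (W : set dual_space) : weak_star_open W =
  (exists2 A : set {ptws Z -> R^o}, open A & dual_eval @^-1` A = W).
Proof. by []. Qed.

Lemma weak_star_continuous_eval (x : Z) :
  continuous (fun f : weak_star => dual_eval f x : R^o).
Proof.
move=> f; apply: (@continuous_comp weak_star {ptws Z -> R^o} R^o
  dual_eval (fun g => g x)); first exact: initial_continuous.
exact: (@proj_continuous _ (fun=> R^o) x).
Qed.

End dual_space.

Section roughness.
Context {R : realType}.

Definition diameter (Z : normedModType R) (A : set Z) : \bar R :=
  ereal_sup [set `|x.1 - x.2|%:E | x in A `*` A].

Definition weak_star_relopen_ball (Z : normedModType R)
    (U : set (dual_space Z)) : Prop :=
  exists2 W, weak_star_open W & U = W `&` unit_ball (dual_space Z).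

Definition weakly_average_rough (Z : normedModType R) (e : R) : Prop :=
  forall U : set (dual_space Z),
    weak_star_relopen_ball U -> U !=set0 -> (e%:E <= diameter U)%E.

Definition weakly_average_non_rough (Z : normedModType R) : Prop :=
  forall e : R, 0 < e -> ~ weakly_average_rough Z e.

End roughness.

Section quotient_space.
Context {R : realType} {X : normedModType R} (Y : submodClosed X).
Local Open Scope quotient_scope.

Lemma submod_zmod_closed : zmod_closed Y.
Proof. by case: (submodClosedP Y) => Y0 /GRing.linear_closedB. Qed.

Definition submod_zmod : zmodClosed X :=
  HB.pack (GRing.SubmodClosed.sort Y)
    (GRing.isZmodClosed.Build X (GRing.SubmodClosed.sort Y) submod_zmod_closed).

(* The proof argument is a phantom: it is what makes the quotient norm
   separated, so that the normed structure can be inferred from the type. *)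
Definition quotient_space (cY : closed [set y : X | y \in Y]) : Type :=
  Quotient.quot submod_zmod.

Variable cY : closed [set y : X | y \in Y].
Local Notation Q := (quotient_space cY).

HB.instance Definition _ := GRing.Zmodule.on Q.

Definition qproj (x : X) : Q := \pi_(Quotient.quot submod_zmod) x.

Lemma qproj_surj (q : Q) : exists x, qproj x = q.
Proof. by exists (repr (q : Quotient.quot submod_zmod)); rewrite /qproj reprK. Qed.

Lemma qproj_eq x x' : qproj x = qproj x' <-> x - x' \in Y.
Proof.
by rewrite -[_ - _ \in Y]/(_ - _ \in submod_zmod) Quotient.idealrBE;
  split=> /eqP.
Qed.

Lemma qprojD x x' : qproj (x + x') = qproj x + qproj x'.
Proof. exact: (@Quotient.pi_add _ submod_zmod). Qed.

Definition qscale (a : R) (q : Q) : Q :=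
  qproj (a *: repr (q : Quotient.quot submod_zmod)).

Lemma qscaleE a x : qscale a (qproj x) = qproj (a *: x).
Proof.
apply/qproj_eq; rewrite -scalerBr rpredZ//; apply/qproj_eq.
by rewrite /qproj reprK.
Qed.

Lemma qscaleA a b q : qscale a (qscale b q) = qscale (a * b) q.
Proof. by have [x <-] := qproj_surj q; rewrite !qscaleE scalerA. Qed.

Lemma qscale1 : left_id 1 qscale.
Proof. by move=> q; have [x <-] := qproj_surj q; rewrite qscaleE scale1r. Qed.

Lemma qscaleDr : right_distributive qscale +%R.
Proof.
move=> a q r; have [x <-] := qproj_surj q; have [y <-] := qproj_surj r.
by rewrite -qprojD !qscaleE -qprojD scalerDr.
Qed.

Lemma qscaleDl q : {morph qscale^~ q : a b / a + b}.
Proof.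
by move=> a b; have [x <-] := qproj_surj q; rewrite !qscaleE -qprojD scalerDl.
Qed.

HB.instance Definition _ := GRing.Zmodule_isLmodule.Build R Q
  qscaleA qscale1 qscaleDr qscaleDl.

Lemma qproj_is_linear : linear qproj.
Proof. by move=> a x y; rewrite qprojD -qscaleE. Qed.

HB.instance Definition _ :=
  GRing.isLinear.Build R X Q *:%R qproj qproj_is_linear.

Definition quotient_norm (q : Q) : R :=
  inf [set `|x| | x in [set x | qproj x = q]].

Lemma quotient_has_inf (q : Q) : has_inf [set `|x| | x in [set x | qproj x = q]].
Proof.
split; last by exists 0 => _ [x _ <-].
by have [x xq] := qproj_surj q; exists `|x|; exists x.
Qed.

Lemma quotient_norm_lb x : quotient_norm (qproj x) <= `|x|.
Proof.
by apply: ge_inf; [exact: (quotient_has_inf (qproj x)).2|exists x].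
Qed.

Lemma quotient_norm_ge q r :
  (forall x, qproj x = q -> r <= `|x|) -> r <= quotient_norm q.
Proof.
move=> rq; apply: lb_le_inf; first exact: (quotient_has_inf q).1.
by move=> _ [x xq <-]; exact: rq.
Qed.

Lemma quotient_norm_approx q e : 0 < e ->
  exists2 x, qproj x = q & `|x| < quotient_norm q + e.
Proof.
by move=> e0; have [_ [x xq <-] xe] := inf_adherent e0 (quotient_has_inf q);
  exists x.
Qed.

Lemma quotient_norm_ge0 q : 0 <= quotient_norm q.
Proof. exact: quotient_norm_ge. Qed.

Lemma quotient_normD q r :
  quotient_norm (q + r) <= quotient_norm q + quotient_norm r.
Proof.
apply/ler_addgt0Pr => e e0; have e20 : 0 < e / 2 by rewrite divr_gt0.
have [x xq xe] := quotient_norm_approx q e20.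
have [y yr ye] := quotient_norm_approx r e20.
have /ltW := ltrD xe ye; rewrite addrACA -splitr; apply: le_trans.
rewrite -[in leLHS]xq -[in leLHS]yr -qprojD.
by rewrite (le_trans (quotient_norm_lb _))// ler_normD.
Qed.

Lemma quotient_normZ a q : quotient_norm (a *: q) = `|a| * quotient_norm q.
Proof.
have [->|a0] := eqVneq a 0.
  rewrite scale0r normr0 mul0r; apply/eqP; rewrite eq_le quotient_norm_ge0.
  by rewrite -(linear0 qproj) (le_trans (quotient_norm_lb _))// normr0.
have ge_normZ b r : b != 0 -> `|b| * quotient_norm r <= quotient_norm (b *: r).
  move=> b0; apply: quotient_norm_ge => x xr.
  rewrite -ler_pdivlMl ?normr_gt0// -normfV -normrZ.
  rewrite (le_trans _ (quotient_norm_lb _))// linearZ/= xr.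
  by rewrite scalerA mulVf// scale1r.
apply/eqP; rewrite eq_le ge_normZ// andbT.
rewrite -ler_pdivrMl ?normr_gt0// -normfV.
by rewrite (le_trans (ge_normZ _ _ _)) ?invr_eq0// scalerA mulVf// scale1r.
Qed.

Lemma quotient_norm0_eq0 q : quotient_norm q = 0 -> q = 0.
Proof.
have [x <-] := qproj_surj q => q0; rewrite -(linear0 qproj).
apply/qproj_eq; rewrite subr0; apply: cY => B /nbhs_ballP [e /= e0 eB].
have [z zx] := quotient_norm_approx (qproj x) e0; rewrite q0 add0r => ze.
exists (x - z); split; first by apply/qproj_eq.
by apply: eB; rewrite -ball_normE/= opprB addrC subrK.
Qed.

HB.instance Definition _ := Lmodule_isNormed.Build R Q
  quotient_normD quotient_normZ quotient_norm0_eq0.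

Lemma quotient_normE x : `|qproj x| = inf [set `|x - y| | y in [set` Y]].
Proof.
congr inf; apply/seteqP; split=> _ [z /= zx <-].
  by exists (x - z); [apply/qproj_eq; rewrite zx|rewrite opprB addrC subrK].
exists (x - z) => //; apply/qproj_eq.
by rewrite addrAC subrr add0r -scaleN1r rpredZ.
Qed.

End quotient_space.

Section finite_dimensional.
Context {R : realType} {X : normedModType R}.

Definition finite_dimensional (Y : submodClosed X) : Prop :=
  exists n (v : 'I_n -> X), (forall i, v i \in Y) /\
    forall y, y \in Y -> exists c : 'I_n -> R, y = \sum_(i < n) c i *: v i.

Lemma closed_add_line (A : set X) (v : X) :
  A 0 -> (forall a x y, A x -> A y -> A (a *: x + y)) -> closed A ->
  closed [set x | exists c : R, A (x - c *: v)].
Proof.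
move=> A0 Alin cA.
have AZ a x : A x -> A (a *: x) by move=> Ax; rewrite -[_ *: _]addr0; apply: Alin.
have AD x y : A x -> A y -> A (x + y) by rewrite -{2}[x]scale1r; apply: Alin.
have AB x y : A x -> A y -> A (x - y).
  by move=> Ax /(AZ (-1)); rewrite scaleN1r; exact: AD.
have [Av|nAv] := pselect (A v).
  rewrite [X in closed X](_ : _ = A)//; apply/seteqP; split=> [x [c Ax]|x Ax].
    by rewrite -(subrK (c *: v) x); apply: AD => //; exact: AZ.
  by exists 0; rewrite scale0r subr0.
have [d d0 dA] : exists2 d : R, 0 < d & forall a, A a -> d <= `|v - a|.
  have : nbhs v (~` A) by apply: open_nbhs_nbhs; split => //; exact: closed_openC.
  move=> /nbhs_ballP[d /= d0 dA]; exists d => // a Aa; rewrite leNgt.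
  by apply/negP => vad; apply: (dA a) => //; rewrite -ball_normE.
have cle c x : A (x - c *: v) -> `|c| * d <= `|x|.
  move=> Ax; have [->|c0] := eqVneq c 0; first by rewrite normr0 mul0r.
  have /(AZ (- c^-1))/dA := Ax.
  rewrite scalerBr scalerA mulNr mulVf// scaleN1r opprK addrC.
  rewrite scaleNr opprD opprK -addrA addNr addr0 normrZ normfV.
  by rewrite ler_pdivlMl ?normr_gt0.
move=> z Sz; set S := [set x | _] in Sz *.
have /choice[c cS] : forall x, exists c, S x -> A (x - c *: v).
  by move=> x; have [[c Ac]|nSx] := pselect (S x); [exists c|exists 0].
pose F := within S (nbhs z).
have PF : ProperFilter F by exact: within_nbhs_proper.
have FS : \forall x \near F, S x by exact: withinT.
have cdist x y : S x -> S y -> `|c x - c y| * d <= `|x - y|.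
  move=> /cS Ax /cS Ay; apply: cle.
  rewrite (_ : _ - _ = (x - c x *: v) - (y - c y *: v)); first exact: AB.
  by rewrite scalerBl !opprD !opprK addrACA.
have : cvg (c @ F).
  apply: R_complete; apply/cauchy_exP => e e0.
  have ed0 : 0 < e * d / 2 by rewrite divr_gt0// mulr_gt0.
  have Fz : \forall x \near F, `|z - x| < e * d / 2.
    by apply: cvg_within; exact: (@cvgr_dist_lt _ _ _ _ _ id z).
  have [w [Sw wz]] := @filter_ex _ _ PF _ (filterI FS Fz).
  exists (c w); rewrite /= !near_simpl.
  near=> x; rewrite -ball_normE /=.
  rewrite -(ltr_pM2r d0); apply: (le_lt_trans (cdist _ _ Sw _)).
    by near: x.
  rewrite [ltRHS]splitr (le_lt_trans (ler_distD z _ _))//.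
  by rewrite ltrD//; [rewrite distrC|near: x].
move=> /cvg_ex[c0 cc0]; exists c0.
apply: (@closed_cvg _ _ F PF (fun x => x - c x *: v) A cA).
  by near=> x; apply: cS; near: x.
apply: cvgB; first exact: cvg_within.
exact: cvgZl.
Unshelve. all: by end_near. Qed.

Lemma closed_span n (v : 'I_n -> X) :
  closed [set y | exists c : 'I_n -> R, y = \sum_(i < n) c i *: v i].
Proof.
elim: n v => [|n IHn] v.
  rewrite [X in closed X](_ : _ = [set 0]).
    exact/accessible_closed_set1/hausdorff_accessible/norm_hausdorff.
  apply/seteqP; split=> [_ [c ->]|_ ->] /=; first by rewrite big_ord0.
  by exists (fun=> 0); rewrite big_ord0.
pose w i := v (widen_ord (leqnSn n) i).
set B := [set x | _].
have <- : [set x | exists c : R, [set y | exists c : 'I_n -> R,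
    y = \sum_(i < n) c i *: w i] (x - c *: v ord_max)] = B.
  apply/seteqP; split=> x /=.
    move=> [a [c /eqP]]; rewrite subr_eq => /eqP ->.
    exists (fun i => if unlift ord_max i is Some j then c j else a).
    rewrite big_ord_recr /= unlift_none; congr (_ + _).
    apply: eq_bigr => i _; congr (_ *: _).
    have -> : widen_ord (leqnSn n) i = lift ord_max i.
      by apply/val_inj; rewrite /= /bump leqNgt ltn_ord.
    by rewrite liftK.
  move=> [c ->]; exists (c ord_max).
  exists (fun i => c (widen_ord (leqnSn n) i)).
  by rewrite big_ord_recr /= addrK.
apply: closed_add_line (IHn w).
- by exists (fun=> 0); rewrite big1// => i _; rewrite scale0r.
- move=> a x y [c ->] [c' ->]; exists (fun i => a * c i + c' i).
  rewrite scaler_sumr -big_split /=; apply: eq_bigr => i _.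
  by rewrite scalerDl scalerA.
Qed.

Lemma finite_dimensional_closed (Y : submodClosed X) :
  finite_dimensional Y -> closed [set y : X | y \in Y].
Proof.
move=> [n [v [vY Yv]]].
rewrite [X in closed X](_ : _ =
  [set y | exists c : 'I_n -> R, y = \sum_(i < n) c i *: v i]).
  exact: closed_span.
apply/seteqP; split=> y /=; first exact: Yv.
by move=> [c ->]; apply: rpred_sum => i _; exact: rpredZ.
Qed.

End finite_dimensional.

(* Main.v *)
(** The dual of [X / Y] is the annihilator of [Y] in the dual of [X].  There is
    a weak-star continuous finite-rank perturbation [P] of the identity of the
    dual of [X] with values in that annihilator, and [f - P f] is small as soon
    as [f] is small on a finite spanning family of [Y].  If [W] is weak-star
    open and meets the unit ball of the annihilator in a set of small diameter,
    then for small [eta > 0] the functionals [f] of the unit ball such that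
    [(1 - eta) *: P f] is in [W] and [f] is small on the spanning family form a
    nonempty relatively weak-star open set; the factor [1 - eta] brings [P f]
    back into the unit ball, so this set lies within [3 * eta] of [W] and has
    small diameter too. *)
From HB Require Import structures.
Require Import Defs.
From mathcomp Require Import all_boot all_order all_algebra.
From mathcomp Require Import all_classical all_reals all_analysis.
From mathcomp Require Import ring lra.

Set Implicit Arguments.
Unset Strict Implicit.
Unset Printing Implicit Defensive.

Import Order.TTheory GRing.Theory Num.Theory.
Import numFieldNormedType.Exports.

Local Open Scope classical_set_scope.
Local Open Scope ring_scope.

Lemma dual_eqP (R : realType) (Z : normedModType R) (f g : dual_space Z) :
  f =1 g -> f = g.
Proof. by move=> fg; apply/val_inj/funext. Qed.

Lemma dual_funB (R : realType) (Z : normedModType R) (f g : dual_space Z) x :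
  (f - g) x = f x - g x.
Proof. by []. Qed.

Lemma dual_fun_sum (R : realType) (Z : normedModType R) n
    (f : 'I_n -> dual_space Z) x : (\sum_(i < n) f i) x = \sum_(i < n) f i x.
Proof.
exact: (big_morph (fun f : dual_space Z => f x : R)
  (fun f g => dual_funD f g x) (erefl : (0 : dual_space Z) x = 0)).
Qed.

Lemma dual_fun_le (R : realType) (Z : normedModType R) (f : dual_space Z) x :
  `|f x| <= `|f| * `|x|.
Proof.
have [->|x0] := eqVneq x 0; first by rewrite linear0 !normr0 mulr0.
have nx0 : 0 < `|x| by rewrite normr_gt0.
have x1 : unit_ball Z (`|x|^-1 *: x) by rewrite /unit_ball /= normfZV.
have := dual_norm_ub f x1.
rewrite linearZ /= normrZ normfV normr_id => h.
by rewrite mulrC -ler_pdivrMl.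
Qed.

Lemma dual_norm_bound (R : realType) (Z : normedModType R) (f : dual_space Z)
    (r : R) :
  0 <= r -> (forall x, `|f x| <= r * `|x|) -> `|f| <= r.
Proof.
by move=> r0 fr; apply: dual_norm_le => x x1; rewrite (le_trans (fr x))// ler_piMr.
Qed.

Lemma dual_of_bounded (R : realType) (Z : normedModType R) (g : Z -> R^o)
    (r : R) :
  0 <= r -> linear g -> (forall x, `|g x| <= r * `|x|) ->
  exists2 f : dual_space Z, f =1 g & `|f| <= r.
Proof.
move=> r0 lg gr.
pose G : {linear Z -> R^o} := HB.pack g (GRing.isLinear.Build R Z R^o *:%R g lg).
have cg : continuous g.
  apply: (@bounded_linear_continuous _ _ _ G); apply/linear_boundedP.
  apply: filterS (nbhs_pinfty_ge (num_real r)) => s rs x.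
  by rewrite (le_trans (gr x))// ler_wpM2r.
have gP : g \in @dual_pred R Z by rewrite inE.
by exists (Dual gP) => //; exact: dual_norm_bound.
Qed.

Section quotient_dual.
Context (R : realType) (X : normedModType R) (Y : submodClosed X).
Variable cY : closed [set y : X | y \in Y].
Local Notation Q := (quotient_space cY).

Lemma dual_pullback (q : dual_space Q) :
  exists2 f : dual_space X, forall x, f x = q (qproj cY x) & `|f| <= `|q|.
Proof.
apply: dual_of_bounded => // [a x y|x]; first by rewrite !linearP.
rewrite (le_trans (dual_fun_le _ _))// ler_wpM2l//.
exact: quotient_norm_lb.
Qed.

(** As [g] vanishes on [Y], the choice of representative made by [s] does not matter; the bound
    [|g| * |x|] holds for every representative [x], hence passes to the infimum defining the
    quotient norm. With [dual_pullback] this makes the dual of the quotient isometric to the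
    annihilator of [Y]. *)
Lemma dual_descend (g : dual_space X) : (forall y, y \in Y -> g y = 0) ->
  exists2 q : dual_space Q, forall x, q (qproj cY x) = g x & `|q| <= `|g|.
Proof.
move=> gY; have /choice[s sK] := @qproj_surj R X Y cY.
have gs x : g (s (qproj cY x)) = g x.
  have /qproj_eq/gY := sK (qproj cY x).
  by rewrite linearB => /eqP; rewrite subr_eq0 => /eqP.
have [||q qE qg] := @dual_of_bounded R Q (g \o s) `|g| (normr_ge0 g).
- move=> a u v; rewrite -(sK u) -(sK v) -linearP /= !gs; exact: linearP.
- move=> u; have [g0|g0] := eqVneq `|g| 0.
    by move: (dual_fun_le g (s u)); rewrite g0 !mul0r.
  have gp : 0 < `|g| by rewrite lt_neqAle eq_sym g0 /=.
  rewrite mulrC -ler_pdivrMr//; apply: quotient_norm_ge => x xu.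
  by rewrite ler_pdivrMr// mulrC -xu /= gs dual_fun_le.
by exists q => // x; rewrite qE /= gs.
Qed.

End quotient_dual.

(* Choosing the [phi i] among the functionals at hand, one vector at a time,
   avoids extending functionals from the span of the [v i]. *)
Lemma annihilator_projection (R : realType) (Z : normedModType R) n
    (v : 'I_n -> Z) :
  exists phi : 'I_n -> dual_space Z, forall (f : dual_space Z) j,
    f (v j) = \sum_(i < n) f (v i) * phi i (v j).
Proof.
elim: n v => [|n IHn] v; first by exists (fun=> 0) => f [].
pose w i := v (lift ord_max i); have [phi phiE] := IHn w.
pose P (f : dual_space Z) := f - \sum_(i < n) f (w i) *: phi i.
have PE f x : P f x = f x - \sum_(i < n) f (w i) * phi i x.
  by rewrite dual_funB dual_fun_sum.
have Pw f j : P f (w j) = 0 by rewrite PE -phiE subrr.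
(* [psi] is some [P f] rescaled to take the value 1 at the last vector, or 0 if every [P f] vanishes
   there. *)
have [psi psiw psiv] : exists2 psi : dual_space Z,
    forall j, psi (w j) = 0 &
    forall f, P f (v ord_max) = P f (v ord_max) * psi (v ord_max).
  have [P0|/existsNP[f f0]] := pselect (forall f, P f (v ord_max) = 0).
    by exists 0 => // f; rewrite P0 mul0r.
  exists ((P f (v ord_max))^-1 *: P f) => [j|g].
    by rewrite dual_funZ Pw mulr0.
  by rewrite dual_funZ mulVf ?mulr1//; exact/eqP.
(* With this family the sum is [\sum_i f (w i) * phi i + P f (v ord_max) * psi], evaluated at
   [v j]. *)
exists (fun i => if unlift ord_max i is Some j
                 then phi j - phi j (v ord_max) *: psi else psi) => f j.
rewrite big_ord_recr /= unlift_none.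
under eq_bigr => i _.
  have -> : widen_ord (leqnSn n) i = lift ord_max i.
    by apply/val_inj; rewrite /= /bump leqNgt ltn_ord.
  rewrite liftK -/(w i) dual_funB dual_funZ mulrBr mulrA; over.
rewrite sumrB -mulr_suml -addrA -mulNr -mulrDl [X in _ + X * _]addrC -PE.
have [i ->|->] := unliftP ord_max j.
  by rewrite -/(w i) psiw mulr0 addr0; exact: phiE.
by rewrite -psiv PE addrC subrK.
Qed.

Lemma continuous_lincomb (R : realType) (T : topologicalType) n
    (h : 'I_n -> T -> R) (c : 'I_n -> R) :
  (forall i, continuous (h i)) -> continuous (fun t => \sum_(i < n) h i t * c i).
Proof.
move=> ch; apply: continuous_big => [|i _ t]; first exact: add_continuous.
by apply: cvgM; [exact: ch|exact: cvg_cst].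
Qed.

Lemma weak_star_continuousP (R : realType) (T : topologicalType)
    (Z : normedModType R) (h : T -> weak_star Z) :
  (forall z, continuous (fun t => dual_eval (h t) z : R^o)) -> continuous h.
Proof.
move=> hz; apply: continuous_comp_initial => t.
by apply/pointwise_cvgP => z; exact: hz.
Qed.

Lemma diameter_lt (R : realType) (Z : normedModType R) (A : set Z) (r : R)
    (x y : Z) :
  (diameter A < r%:E)%E -> A x -> A y -> `|x - y| < r.
Proof.
move=> Ar Ax Ay; rewrite -lte_fin; apply: le_lt_trans Ar.
by apply: ereal_sup_ubound; exists (x, y).
Qed.

Theorem theorem2p12 (R : realType) (X : completeNormedModType R)
    (Y : submodClosed X) (fY : finite_dimensional Y) :
  weakly_average_non_rough (quotient_space (finite_dimensional_closed fY)) ->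
  weakly_average_non_rough X.
Proof.
move=> nrQ e e0 rX.
move: (finite_dimensional_closed fY) nrQ => cY nrQ.
have [n [v [vY Yv]]] := fY.
have [phi phiE] := annihilator_projection v.
(* Half of [e] is spent on the diameter in the dual of the quotient; the other half absorbs the
   perturbation. *)
have /nrQ/existsNP[_ /not_implyP[[W oW ->] /not_implyP[[q0 [Wq0 q01]]]]] :
  0 < e / 2 by rewrite divr_gt0.
move=> /negP; rewrite -ltNge => dW.
pose S (f : dual_space X) := \sum_(i < n) `|f (v i)| * `|phi i|.
pose P (f : dual_space X) := f - \sum_(i < n) f (v i) *: phi i.
have PE f x : P f x = f x - \sum_(i < n) f (v i) * phi i x.
  by rewrite dual_funB dual_fun_sum.
have Pv f i : P f (v i) = 0 by rewrite PE -phiE subrr.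
have PY f y : y \in Y -> P f y = 0.
  move=> /Yv[c ->]; rewrite linear_sum big1// => i _.
  by rewrite linearZ /= [X in _ *: X]Pv scaler0.
have fP f : `|f - P f| <= S f.
  rewrite opprB addrC subrK (le_trans (ler_norm_sum _ _ _))//.
  by apply: ler_sum => i _; rewrite normrZ.
have /choice[D DP] : forall f, exists q : dual_space (quotient_space cY),
    (forall x, q (qproj cY x) = P f x) /\ `|q| <= `|P f|.
  by move=> f; have [q] := dual_descend cY (PY f); exists q.
(* The bound [e / 16] gives [e / 2 + 6 * eta < e] at the end. Shrinking [q0] slightly keeps it in
   [W], since [W] is weak-star open. *)
have [eta [eta0 eta1 etae Weta]] : exists eta : R,
    [/\ 0 < eta, eta <= 1, eta <= e / 16 & W ((1 - eta) *: q0)].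
  have cq : continuous (fun t : R => ((1 - t) *: q0 : weak_star _)).
    apply: weak_star_continuousP => z t.
    apply: (@cvgM _ R _ _ (fun t : R => 1 - t) (fun=> q0 z)).
      by apply: cvgB; [exact: cvg_cst|exact: cvg_id].
    exact: cvg_cst.
  have W0 : nbhs (0 : R) (fun t => W ((1 - t) *: q0)).
    apply: cq; apply: open_nbhs_nbhs; split => //.
    by rewrite subr0 scale1r.
  have : \forall t \near 0^'+, W ((1 - t) *: q0) by exact: cvg_within W0.
  move=> Wt; near (0 : R)^'+ => t; exists t; split => //; near: t => //.
  - exact: nbhs_right_le.
  - by apply: nbhs_right_le; rewrite divr_gt0.
pose Phi f := (1 - eta) *: D f.
pose V : set (dual_space X) := [set f | W (Phi f) /\ S f < eta].
have ceval x : continuous (fun f : weak_star X => dual_fun f x : R).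
  exact: weak_star_continuous_eval.
have cP x : continuous (fun f : weak_star X => dual_fun (P f) x : R).
  rewrite [F in continuous F](_ : _ = (fun f : weak_star X =>
    dual_fun f x - \sum_(i < n) dual_fun f (v i) * phi i x : R)).
    move=> f; apply: (@continuousB R R (weak_star X)); first exact: ceval.
    by apply: (@continuous_lincomb R (weak_star X)) => i; exact: ceval.
  by apply/funext => f; rewrite PE.
have oV : weak_star_open V.
  apply: openI.
    (* Although [D] comes from a choice, at the class of [x] the value of [Phi f] is
       [(1 - eta) * P f x], a finite combination of evaluations of [f]. *)
    apply: (@open_comp (weak_star X) (weak_star (quotient_space cY)) Phi) => //.
    move=> f _; move: f; apply: weak_star_continuousP => u.
    have [x <-] := qproj_surj u.
    rewrite [F in continuous F](_ : _ =
      (fun f : weak_star X => (1 - eta) * P f x : R)).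
      move=> f; apply: (@continuousM R (weak_star X) (fun=> 1 - eta)).
        exact: cst_continuous.
      exact: cP.
    by apply/funext => f; rewrite -(DP f).1.
  apply: (@open_comp (weak_star X) R S [set r | r < eta]); last exact: open_lt.
  move=> f _; apply: (@continuous_lincomb R (weak_star X)) => i g.
  apply: (@continuous_comp (weak_star X) R R (fun f => dual_fun f (v i))).
    exact: ceval.
  exact: norm_continuous.
(* The pullback of [q0] kills [Y], so [P] fixes it and [Phi f0] is [(1 - eta) *: q0], which lies in
   [W]. *)
have [f0 f0E f0q] := dual_pullback q0.
have f0Y i : f0 (v i) = 0.
  rewrite f0E -[RHS](linear0 q0); congr (q0 _).
  by rewrite -(linear0 (qproj cY)); apply/qproj_eq; rewrite subr0.
have VB0 : (V `&` unit_ball (dual_space X)) f0.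
  split; last exact: le_trans q01.
  split; last by rewrite /S big1// => i _; rewrite f0Y normr0 mul0r.
  rewrite /Phi (_ : D f0 = q0)//; apply: dual_eqP => u.
  have [x <-] := qproj_surj u.
  rewrite (DP f0).1 PE big1 ?subr0// => i _.
  by rewrite f0Y mul0r.
(* The norm bound is [(1 - eta) * (1 + eta) <= 1]. The factor 3 is 1 from [f - P f] plus 2 from
   [eta * P f], where [|P f| <= 1 + eta <= 2]. *)
have PhiP f : V f -> `|f| <= 1 ->
    `|Phi f| <= 1 /\ forall x, `|f x - Phi f (qproj cY x)| <= 3 * eta * `|x|.
  move=> [_ Sf] f1.
  have fPeta : `|f - P f| <= eta by rewrite (le_trans (fP f))// ltW.
  have P1 : `|P f| <= 1 + eta.
    rewrite -[P f](subrK f) addrC (le_trans (ler_normD _ _))// lerD//.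
    by rewrite distrC.
  have eta1' : 0 <= 1 - eta by rewrite subr_ge0.
  split=> [|x].
    rewrite normrZ ger0_norm//.
    have Dn : `|D f| <= 1 + eta := le_trans (DP f).2 P1.
    by rewrite (le_trans (ler_wpM2l eta1' Dn))//; nra.
  rewrite dual_funZ (DP f).1.
  rewrite (_ : _ - _ = (f - P f) x + eta * P f x); last first.
    by rewrite dual_funB; ring.
  have h1 := dual_fun_le (f - P f) x.
  have h2 := dual_fun_le (P f) x.
  rewrite (le_trans (ler_normD _ _))// normrM (gtr0_norm eta0).
  have h3 := ler_wpM2r (normr_ge0 x) fPeta.
  have h4 := ler_wpM2r (normr_ge0 x) P1.
  have h5 : eta * `|P f x| <= eta * ((1 + eta) * `|x|).
    by apply: ler_wpM2l; [exact: ltW|exact: le_trans h2 h4].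
  have h6 : eta * (1 + eta) * `|x| <= 2 * eta * `|x|.
    by rewrite ler_wpM2r//; nra.
  lra.
have := rX _ (ex_intro2 _ _ V oV erefl) (ex_intro _ f0 VB0).
suff : (diameter (V `&` unit_ball (dual_space X)) <= (e / 2 + 6 * eta)%:E)%E.
  by move=> h1 h2; have := le_trans h2 h1; rewrite lee_fin; lra.
apply: ge_ereal_sup => _ [[f g] [/= [Vf f1] [Vg g1]] <-].
rewrite lee_fin.
have [Pf fx] := PhiP f Vf f1; have [Pg gx] := PhiP g Vg g1.
have PP : `|Phi f - Phi g| < e / 2.
  apply: diameter_lt dW _ _; split => //; [exact: Vf.1|exact: Vg.1].
apply: dual_norm_bound => [|x]; first lra.
have h : `|Phi f (qproj cY x) - Phi g (qproj cY x)| <= e / 2 * `|x|.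
  rewrite -dual_funB (le_trans (dual_fun_le _ _))//.
  by apply: ler_pM => //; [exact: ltW|exact: quotient_norm_lb].
(* The two outer terms cost [3 * eta] each and the middle one [e / 2]. *)
have -> : (f - g) x = (f x - Phi f (qproj cY x)) +
  (Phi f (qproj cY x) - Phi g (qproj cY x)) - (g x - Phi g (qproj cY x)).
  by rewrite dual_funB; ring.
rewrite (le_trans (ler_normB _ _))// (le_trans (lerD (ler_normD _ _) (lexx _)))//.
have := fx x; have := gx x; lra.
Unshelve. all: by end_near. Qed.
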